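(* Let $\Omega:\mathbb M_m\to\mathbb M_n$ be completely positive with minimal Kraus representation $\Omega(B)=\sum_{i=1}^r V_i^*BV_i$ (so $V_1,\dots,V_r$ are linearly independent), and let $\Lambda:\mathbb M_\ell\to\mathbb M_m$ be completely positive with a (not necessarily minimal) Kraus representation $\Lambda(A)=\sum_{j=1}^s L_j^*AL_j$. Let $$\mathcal R_{\Lambda,\Omega}=\Big\{c=(c_{ji})\in\mathbb C^s\otimes\mathbb C^r:\ \sum_{j=1}^s\sum_{i=1}^r c_{ji}\,L_jV_i=0\Big\},\qquad \mathcal E_{\Lambda,\Omega}=\mathcal R_{\Lambda,\Omega}^{\perp}\subseteq\mathbb C^s\otimes\mathbb C^r,$$ and let $P_{\mathcal E}$ be the orthogonal projection of $\mathbb C^s\otimes\mathbb C^r$ onto $\mathcal E_{\Lambda,\Omega}$. Let $P\in\mathbb M_r$ be a projection, put $R_P=I_s\otimes P$, and let $\Delta_{\Lambda,\Omega}(P)=\mathcal T_\Lambda^\Omega(P)-\mathcal T_\Lambda^\Omega(P)^2\in B(\mathcal E_{\Lambda,\Omega})$ be the sharpness-loss defect of $P$ under pullback by $\Lambda$. Then $$\Delta_{\Lambda,\Omega}(P)=P_{\mathcal E}R_P(I-P_{\mathcal E})R_PP_{\mathcal E}\big|_{\mathcal E_{\Lambda,\Omega}}\qquad\text{and}\qquad \|\Delta_{\Lambda,\Omega}(P)\|=\|(I-P_{\mathcal E})R_PP_{\mathcal E}\|^2.$$ Moreover, $\Delta_{\Lambda,\Omega}(P)=0$ if and only if the pullback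 $\Omega_P\circ\Lambda\le\Omega\circ\Lambda$ is sharp (relative to $\Omega\circ\Lambda$). In particular, $\|\Delta_{\Lambda,\Omega}(P)\|$ gives a quantitative measure of the failure of the sharp submap $\Omega_P$ to remain sharp after pullback by $\Lambda$.
   Context: For completely positive maps, $\Phi\le\Psi$ means $\Psi-\Phi$ is completely positive. Radon--Nikodym theorem (known): if $\Psi(C)=T^*\sigma(C)T$ is a minimal Stinespring representation of a completely positive map and $\Phi$ is completely positive with $\Phi\le c\,\Psi$ for some $c\ge0$, there is a unique positive $E$ in the commutant of the range of $\sigma$ with $\Phi(C)=T^*\sigma(C)ET$ for all $C$; it is denoted $\frac{\mathrm d\Phi}{\mathrm d\Psi}$. A completely positive $\Phi\le\Psi$ is sharp relative to $\Psi$ if $\frac{\mathrm d\Phi}{\mathrm d\Psi}$ is a projection. With $(f_i)$ the standard basis of $\mathbb C^r$, the minimal Stinespring representation of $\Omega$ is $\pi_\Omega(B)=B\otimes I_r$ on $\mathbb C^m\otimes\mathbb C^r$ with $\mathsf V_\Omega\xi=\sum_iV_i\xi\otimes f_i$, and $D\in\mathbb M_r$ is identified with $I_m\otimes D\in\pi_\Omega(\mathbb M_m)'$; for $D=[d_{ij}]\ge0$, $\Omega_D(B)=\mathsf V_\Omega^*(B\otimes I_r)(I_m\otimes D)\mathsf V_\Omega=\sum_{i,j}d_{ij}V_i^*BV_j$. One has $\Omega\circ\Lambda(A)=\sum_{j,i}(L_jV_i)^*A(L_jV_i)$, and the coefficient space of the family $\{L_jV_i\}$ is $\mathbb C^s\otimes\mathbb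 C^r$. Restricting this coefficient space to $\mathcal E_{\Lambda,\Omega}$ removes the linear redundancies of the family, and the minimal Stinespring representation of $\Omega\circ\Lambda$ is taken on $\mathbb C^\ell\otimes\mathcal E_{\Lambda,\Omega}$ with $A\mapsto A\otimes I_{\mathcal E_{\Lambda,\Omega}}$; an operator $X\in B(\mathcal E_{\Lambda,\Omega})$ is identified with $I_\ell\otimes X$ in the commutant. The pullback transfer map is $\mathcal T_\Lambda^\Omega(D)=\frac{\mathrm d(\Omega_D\circ\Lambda)}{\mathrm d(\Omega\circ\Lambda)}\in B(\mathcal E_{\Lambda,\Omega})$ for $D\ge0$ (derivative with respect to the minimal Stinespring representation of $\Omega\circ\Lambda$), extended linearly to $\mathbb M_r$; it is unital and completely positive, and the positive operator $\Delta_{\Lambda,\Omega}(P)$ is its Schwarz defect at $P$.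
   Formalization: The space E is taken as the annihilator of R under the bilinear pairing Σ c_k u_k (the complex conjugate of the Hermitian complement R^⊥), since with the Hermitian complement the defect formula fails for complex Kraus coefficients. *)

(* Defs.v *)
From HB Require Import structures.
From mathcomp Require Export all_boot all_order all_algebra.
From mathcomp Require Export complex mxtens.
From mathcomp Require Export boolp classical_sets reals.

Set Implicit Arguments.
Unset Strict Implicit.
Unset Printing Implicit Defensive.

Import Order.TTheory GRing.Theory Num.Theory.

#[global] Open Scope classical_set_scope.
#[global] Open Scope sesquilinear_scope.
#[global] Open Scope ring_scope.

(* The complex numbers are R[i] for R : realType, B(C^k) is 'M[R[i]]_k acting
   on column vectors, the adjoint is A ^t*, and C^p (x) C^q is 'cV_(p * q)
   through mxtens_index, so that A (x) B is the Kronecker product A *t B. *)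

Section Hilbert.
Variable R : realType.
Local Notation C := R[i].

Definition l2norm (k : nat) (v : 'cV[C]_k) : R :=
  Num.sqrt (\sum_i Normc.normc (v i 0) ^+ 2).

Definition opnorm (p q : nat) (X : 'M[C]_(p, q)) : R :=
  sup [set l2norm (X *m v) | v in [set v : 'cV[C]_q | l2norm v <= 1]].

(* Over the complex numbers this forces A to be Hermitian; 0 <= z in R[i]
   means that z is real and nonnegative. *)
Definition psd (k : nat) (A : 'M[C]_k) : Prop :=
  forall v : 'cV[C]_k, 0 <= (v ^t* *m A *m v) 0 0.

Definition projection (k : nat) (P : 'M[C]_k) : Prop :=
  P ^t* = P /\ P *m P = P.

Definition orthoproj_onto (k : nat) (E : set 'cV[C]_k) (Q : 'M[C]_k) : Prop :=
  projection Q /\ (forall u, E u <-> exists x, u = Q *m x).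

Definition orthoproj (k : nat) (E : set 'cV[C]_k) : 'M[C]_k :=
  xget 0 (orthoproj_onto E).

Definition orthonormal_basis (k d : nat) (E : set 'cV[C]_k)
    (W : 'M[C]_(k, d)) : Prop :=
  W ^t* *m W = 1%:M /\ (forall u, E u <-> exists x, u = W *m x).

(* The matrix, in the orthonormal basis W of a subspace E, of the restriction
   to E of an operator X with X E contained in E. *)
Definition restr (k d : nat) (W : 'M[C]_(k, d)) (X : 'M[C]_k) : 'M[C]_d :=
  W ^t* *m X *m W.

End Hilbert.

Section CompletelyPositive.
Variable R : realType.
Local Notation C := R[i].

Definition completely_positive (p q : nat) (Phi : 'M[C]_p -> 'M[C]_q) : Prop :=
  linear Phi /\
  forall (N : nat) (A : 'I_N -> 'I_N -> 'M[C]_p),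
    psd (\mxblock_(i < N, j < N) A i j) ->
    psd (\mxblock_(i < N, j < N) Phi (A i j)).

Definition cple (p q : nat) (Phi Psi : 'M[C]_p -> 'M[C]_q) : Prop :=
  completely_positive (fun A => Psi A - Phi A).

Definition kraus_map (p q r : nat) (V : 'I_r -> 'M[C]_(p, q))
    (B : 'M[C]_p) : 'M[C]_q :=
  \sum_i (V i) ^t* *m B *m V i.

Definition minimal_kraus (p q r : nat) (Phi : 'M[C]_p -> 'M[C]_q)
    (V : 'I_r -> 'M[C]_(p, q)) : Prop :=
  Phi =1 kraus_map V /\ free [tuple V i | i < r].

Definition star_representation (p k : nat)
    (sigma : 'M[C]_p -> 'M[C]_k) : Prop :=
  [/\ linear sigma, sigma 1%:M = 1%:M,
      forall A B, sigma (A *m B) = sigma A *m sigma B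
    & forall A, sigma (A ^t*) = (sigma A) ^t*].

Definition minimal_stinespring (p q k : nat) (Psi : 'M[C]_p -> 'M[C]_q)
    (sigma : 'M[C]_p -> 'M[C]_k) (T : 'M[C]_(k, q)) : Prop :=
  [/\ star_representation sigma,
      forall A, Psi A = T ^t* *m sigma A *m T
    & forall x : 'cV[C]_k,
        exists (N : nat) (A : 'I_N -> 'M[C]_p) (y : 'I_N -> 'cV[C]_q),
          x = \sum_a sigma (A a) *m T *m y a].

(* E is d Phi / d Psi, computed in the minimal Stinespring representation
   (sigma, T) of Psi. *)
Definition RN_derivative (p q k : nat) (Phi Psi : 'M[C]_p -> 'M[C]_q)
    (sigma : 'M[C]_p -> 'M[C]_k) (T : 'M[C]_(k, q)) (E : 'M[C]_k) : Prop :=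
  [/\ minimal_stinespring Psi sigma T, psd E,
      forall A, E *m sigma A = sigma A *m E
    & forall A, Phi A = T ^t* *m sigma A *m E *m T].

(* Minimal Stinespring representations are unique up to unitary equivalence,
   so the choice of (sigma, T) is immaterial. *)
Definition sharp (p q : nat) (Phi Psi : 'M[C]_p -> 'M[C]_q) : Prop :=
  [/\ completely_positive Phi, cple Phi Psi
    & exists (k : nat) (sigma : 'M[C]_p -> 'M[C]_k) (T : 'M[C]_(k, q))
        (E : 'M[C]_k), RN_derivative Phi Psi sigma T E /\ projection E].

(* The operator xi |-> \sum_i V_i xi (x) f_i. *)
Definition stinespring_op (p q r : nat) (V : 'I_r -> 'M[C]_(p, q)) :
    'M[C]_(p * r, q) :=
  \matrix_(k, j) V (mxtens_unindex k).2 (mxtens_unindex k).1 j.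

Definition submap (p q r : nat) (V : 'I_r -> 'M[C]_(p, q)) (D : 'M[C]_r)
    (B : 'M[C]_p) : 'M[C]_q :=
  (stinespring_op V) ^t* *m (B *t (1%:M : 'M[C]_r)) *m
    ((1%:M : 'M[C]_p) *t D) *m stinespring_op V.

End CompletelyPositive.

Section Pullback.
Variable R : realType.
Local Notation C := R[i].
Variables (l m n r s : nat).
Variables (V : 'I_r -> 'M[C]_(m, n)) (L : 'I_s -> 'M[C]_(l, m)).

Definition composite_kraus (k : 'I_(s * r)) : 'M[C]_(l, n) :=
  L (mxtens_unindex k).1 *m V (mxtens_unindex k).2.

Definition relation_space : set 'cV[C]_(s * r) :=
  [set c | \sum_(j < s) \sum_(i < r)
             c (mxtens_index (j, i)) 0 *: (L j *m V i) = 0].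

(* The complement is taken for the bilinear pairing \sum_k c_k u_k of
   coefficient vectors, not for the inner product (which would give the complex
   conjugate of this space). It is this space, and not its conjugate, for which
   \sum_(j,i) L_j V_i xi (x) e_j (x) f_i lies in C^l (x) E, as the minimal
   Stinespring representation on C^l (x) E requires: given c in relation_space,
   contracting that vector with any functional on C^l produces some u with
   \sum_k c_k u_k = 0. *)
Definition coefficient_space : set 'cV[C]_(s * r) :=
  [set u | forall c, relation_space c -> \sum_k c k 0 * u k 0 = 0].

Section Transfer.
Variables (Omega : 'M[C]_m -> 'M[C]_n) (Lambda : 'M[C]_l -> 'M[C]_m).
(* W is meant to be an orthonormal basis of coefficient_space, through which
   B(coefficient_space) becomes 'M_d and C^l (x) coefficient_space becomes
   C^l (x) C^d. *)
Variables (d : nat) (W : 'M[C]_(s * r, d)).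

Definition pullback_rep (A : 'M[C]_l) : 'M[C]_(l * d) :=
  A *t (1%:M : 'M[C]_d).

Definition pullback_op : 'M[C]_(l * d, n) :=
  ((1%:M : 'M[C]_l) *t W ^t*) *m stinespring_op composite_kraus.

Definition is_transfer (F : 'M[C]_r -> 'M[C]_d) : Prop :=
  linear F /\
  forall D : 'M[C]_r, psd D ->
    RN_derivative (submap V D \o Lambda) (Omega \o Lambda)
      pullback_rep pullback_op ((1%:M : 'M[C]_l) *t F D).

Definition transfer : 'M[C]_r -> 'M[C]_d := xget (fun=> 0) is_transfer.

Definition defect (P : 'M[C]_r) : 'M[C]_d :=
  transfer P - transfer P *m transfer P.

End Transfer.
End Pullback.

(* Main.v *)
Require Import Defs.
From mathcomp Require Import spectral.

(* Let W be an isometry onto the coefficient space, Q = W W^* and let S stack the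
   operators L_j V_i. Every vector of matrix entries (L_j V_i)(a, b) lies in the
   coefficient space, so I (x) Q fixes S; hence D |-> W^* (I (x) D) W computes the
   Radon-Nikodym derivatives of the pullbacks, and the defect at P is X^* X with
   X = (I - Q) R_P W. The norm formula is then the C^*-identity. For sharpness, an
   arbitrary minimal Stinespring representation is compared with the concrete one
   by expanding vectors, which transports idempotency of the derivative. *)

Set Implicit Arguments.
Unset Strict Implicit.
Unset Printing Implicit Defensive.

Import Order.TTheory GRing.Theory Num.Theory.

(** * Adjoints and Kronecker products *)

Section Adjoint.
Variable C : numClosedFieldType.

Lemma adjmxM m n p (A : 'M[C]_(m, n)) (B : 'M[C]_(n, p)) :
  (A *m B) ^t* = B ^t* *m A ^t*.
Proof. by rewrite trmx_mul map_mxM. Qed.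

Lemma adjmx_tens m n p q (A : 'M[C]_(m, n)) (B : 'M[C]_(p, q)) :
  (A *t B) ^t* = A ^t* *t B ^t*.
Proof. by rewrite trmx_tens map_mxT. Qed.

Lemma adjmx1 n : (1%:M : 'M[C]_n) ^t* = 1%:M.
Proof. by rewrite trmx1 map_mx1. Qed.

Lemma adjmxB m n (A B : 'M[C]_(m, n)) : (A - B) ^t* = A ^t* - B ^t*.
Proof. by rewrite linearB map_mxB. Qed.

Lemma adjmx_sum m n (I : finType) (F : I -> 'M[C]_(m, n)) :
  (\sum_i F i) ^t* = \sum_i (F i) ^t*.
Proof. by rewrite linear_sum raddf_sum. Qed.

Lemma adjmxZ m n a (A : 'M[C]_(m, n)) : (a *: A) ^t* = a^* *: A ^t*.
Proof. by rewrite linearZ map_mxZ. Qed.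

Lemma adjmx_mul_eq0 n (v : 'cV[C]_n) : v ^t* *m v = 0 -> v = 0.
Proof.
move=> vv0; rewrite -[v]trmxCK.
suff /eqP -> : v ^t* == 0 by rewrite trmx0 map_mx0.
by apply: contraT => /dotmx_is_dotmx; rewrite dotmxE trmxCK vv0 mxE ltxx.
Qed.

Lemma tensmxBr m n p q (A : 'M[C]_(m, n)) (B B' : 'M[C]_(p, q)) :
  A *t (B - B') = A *t B - A *t B'.
Proof. by apply/matrixP => i j; rewrite !mxE mulrBr. Qed.

Lemma tensmx11 m n : (1%:M : 'M[C]_m) *t (1%:M : 'M[C]_n) = 1%:M.
Proof.
apply/matrixP => i j; rewrite !mxE -natrM mulnb; congr (_ %:R).
rewrite -(can_eq (@mxtens_unindexK m n)).
by case: (mxtens_unindex i) => ? ?; case: (mxtens_unindex j) => ? ?.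
Qed.

Lemma mul1mxP m n (A B : 'M[C]_(m, n)) :
  (forall v : 'cV_n, A *m v = B *m v) -> A = B.
Proof.
move=> AB; apply/matrixP => i j.
by have /colP/(_ i) := AB (delta_mx j 0); rewrite -!colE !mxE.
Qed.

(** The block at [(ord0, ord0)] recovers [A] and [B]; it exists only for positive [l]. *)
Lemma tensmx1_inj l m n (A B : 'M[C]_(m, n)) :
  (0 < l)%N -> (1%:M : 'M[C]_l) *t A = 1%:M *t B -> A = B.
Proof.
case: l => // l _ /matrixP AB; apply/matrixP => i j.
have := AB (mxtens_index (ord0, i)) (mxtens_index (ord0, j)).
by rewrite !tensmxE !mxE eqxx !mul1r.
Qed.
End Adjoint.

(** * Positive semidefinite matrices and orthogonal projections *)

Section PSD.
Variable R : realType.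
Local Notation C := R[i].

Lemma psdD k (A B : 'M[C]_k) : psd A -> psd B -> psd (A + B).
Proof. by move=> pA pB v; rewrite mulmxDr mulmxDl mxE addr_ge0 ?pA ?pB. Qed.

Lemma psd_sum k (I : finType) (F : I -> 'M[C]_k) :
  (forall i, psd (F i)) -> psd (\sum_i F i).
Proof.
move=> pF; apply: (big_ind (@psd R k)) => [v||//]; last exact: psdD.
by rewrite mulmx0 mul0mx mxE.
Qed.

Lemma psd_congr k p (A : 'M[C]_k) (X : 'M[C]_(k, p)) :
  psd A -> psd (X ^t* *m A *m X).
Proof. by move=> pA v; have := pA (X *m v); rewrite adjmxM !mulmxA. Qed.

Lemma psd1 k : psd (1%:M : 'M[C]_k).
Proof.
by move=> v; rewrite mulmx1 mxE sumr_ge0 // => i _; rewrite !mxE mulrC mul_conjC_ge0.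
Qed.

Lemma projection_psd k (P : 'M[C]_k) : projection P -> psd P.
Proof.
case=> Ps PP; have := psd_congr P (@psd1 k).
by rewrite mulmx1 Ps PP.
Qed.

Lemma projectionB k (P : 'M[C]_k) : projection P -> projection (1%:M - P).
Proof.
case=> Ps PP; split; first by rewrite adjmxB adjmx1 Ps.
by rewrite mulmxBr mulmx1 mulmxBl mul1mx PP subrr subr0.
Qed.

Lemma projection_tens k p (P : 'M[C]_p) :
  projection P -> projection ((1%:M : 'M[C]_k) *t P).
Proof. by case=> Ps PP; split; rewrite ?adjmx_tens ?tensmx_mul ?adjmx1 ?mulmx1 ?Ps ?PP. Qed.

Lemma projection_unique k (E : set 'cV[C]_k) (Q Q' : 'M[C]_k) :
  orthoproj_onto E Q -> orthoproj_onto E Q' -> Q = Q'.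
Proof.
move=> [[Qs QQ] EQ] [[Q's Q'Q'] EQ'].
(* A projection fixes its range, so each of two projections with the same range fixes the other; one
   of the two identities is then read through its adjoint. *)
have fix_ (A B : 'M_k) : A *m A = A -> (forall u, E u <-> exists x, u = A *m x) ->
    (forall u, E u <-> exists x, u = B *m x) -> A *m B = B.
  move=> AA EA EB; apply: mul1mxP => v.
  have /EA [x Bv] : E (B *m v) by apply/EB; exists v.
  by rewrite -mulmxA Bv mulmxA AA.
rewrite -[LHS]Qs -(fix_ Q' Q) // adjmxM Qs Q's; exact: fix_.
Qed.

Lemma orthoproj_basis k d (E : set 'cV[C]_k) (W : 'M[C]_(k, d)) :
  orthonormal_basis E W -> orthoproj E = W *m W ^t*.
Proof.
case=> WW EW; have WWon : orthoproj_onto E (W *m W ^t*).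
  split; first by split; rewrite ?adjmxM ?trmxCK // !mulmxA -[W *m _ *m W]mulmxA WW mulmx1.
  move=> u; split=> [/EW [x ->]|[x ->]].
    by exists (W *m x); rewrite -!mulmxA (mulmxA _ W) WW mul1mx.
  by apply/EW; exists (W ^t* *m x); rewrite mulmxA.
apply: (projection_unique _ WWon).
by rewrite /orthoproj; apply: xgetPex; exists (W *m W ^t*).
Qed.

End PSD.

(** * The operator norm and the C*-identity *)

Section OperatorNorm.
Variable R : realType.
Local Notation C := R[i].
Local Open Scope complex_scope.

Lemma l2norm_ge0 k (v : 'cV[C]_k) : 0 <= l2norm v.
Proof. exact: sqrtr_ge0. Qed.

Lemma l2normE k (v : 'cV[C]_k) : (l2norm v ^+ 2)%:C = (v ^t* *m v) 0 0.
Proof.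
rewrite /l2norm sqr_sqrtr ?sumr_ge0 // => [|i _]; last exact: sqr_ge0.
rewrite rmorph_sum mxE; apply: eq_bigr => i _; rewrite !mxE mulrC -normCK.
by rewrite rmorphXn.
Qed.

Lemma l2norm0_eq0 k (v : 'cV[C]_k) : l2norm v = 0 -> v = 0.
Proof.
move=> v0; apply: adjmx_mul_eq0; apply/matrixP => i j.
by rewrite !ord1 -l2normE v0 expr0n mxE.
Qed.

Lemma l2normZ k (a : R) (v : 'cV[C]_k) : 0 <= a -> l2norm (a%:C *: v) = a * l2norm v.
Proof.
move=> a0; apply/eqP; rewrite -(@eqrXn2 _ 2) ?mulr_ge0 ?l2norm_ge0 //.
rewrite -(inj_eq (@complexI R)) l2normE adjmxZ -scalemxAr -scalemxAl scalerA mxE.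
by rewrite conj_Creal ?ger0_real ?ler0c // exprMn rmorphM /= l2normE -rmorphM -expr2.
Qed.

Lemma l2norm_isometry k d (W : 'M[C]_(k, d)) (v : 'cV[C]_d) :
  W ^t* *m W = 1%:M -> l2norm (W *m v) = l2norm v.
Proof.
move=> WW; apply/eqP; rewrite -(@eqrXn2 _ 2) ?l2norm_ge0 //.
rewrite -(inj_eq (@complexI R)) !l2normE adjmxM mulmxA -(mulmxA _ _ W) WW.
by rewrite mulmx1.
Qed.

Lemma l2norm_CauchySchwarz k (u v : 'cV[C]_k) :
  `|(u ^t* *m v) 0 0| <= (l2norm u * l2norm v)%:C.
Proof.
rewrite -ler_sqr ?nnegrE ?normr_ge0 ?ler0c ?mulr_ge0 ?l2norm_ge0 //.
rewrite -[leRHS]rmorphXn /= exprMn rmorphM /=.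
have := (CauchySchwarz (@dotmx C k) (u ^t* ) (v ^t* )).1.
by rewrite /= !dotmxE !trmxCK !l2normE.
Qed.

Lemma l2norm_mulmx_bounded p q (X : 'M[C]_(p, q)) :
  has_ubound [set l2norm (X *m v) | v in [set v : 'cV[C]_q | l2norm v <= 1]].
Proof.
pose r i := l2norm ((row i X) ^t* ).
(* The bound is the Hilbert-Schmidt norm of [X], by Cauchy-Schwarz on each row. *)
exists (Num.sqrt (\sum_i r i ^+ 2)) => _ [v /= v1 <-].
apply: ler_wsqrtr; apply: ler_sum => i _.
rewrite ler_sqr ?nnegrE ?l2norm_ge0 ?sqrtr_ge0 //; last first.
  by case: ((X *m v) i 0) => a b; apply: sqrtr_ge0.
apply: (@le_trans _ _ (r i * l2norm v)); last by rewrite ler_piMr ?l2norm_ge0.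
rewrite -lecR; have := l2norm_CauchySchwarz ((row i X) ^t* ) v.
by rewrite trmxCK -row_mul mxE.
Qed.

Lemma opnorm_ub p q (X : 'M[C]_(p, q)) v : l2norm v <= 1 -> l2norm (X *m v) <= opnorm X.
Proof. by move=> v1; apply: ub_le_sup; [exact: l2norm_mulmx_bounded | exists v]. Qed.

Lemma l2norm0 k : l2norm (0 : 'cV[C]_k) = 0.
Proof. by have := @l2normZ k 0 0 (lexx 0); rewrite scaler0 mul0r. Qed.

Lemma opnorm_le p q (X : 'M[C]_(p, q)) a :
  (forall v, l2norm v <= 1 -> l2norm (X *m v) <= a) -> opnorm X <= a.
Proof.
move=> Xa; apply: ge_sup; last by move=> _ [v v1 <-]; exact: Xa.
by exists (l2norm (X *m 0)); exists 0; rewrite //= l2norm0.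
Qed.

Lemma opnorm_ge0 p q (X : 'M[C]_(p, q)) : 0 <= opnorm X.
Proof. by apply: le_trans (l2norm_ge0 _) (opnorm_ub X (v := 0) _); rewrite l2norm0. Qed.

Lemma l2norm_mulmx_le p q (X : 'M[C]_(p, q)) v :
  l2norm (X *m v) <= opnorm X * l2norm v.
Proof.
have [/l2norm0_eq0 ->|v0] := eqVneq (l2norm v) 0; first by rewrite mulmx0 !l2norm0 mulr0.
have vgt0 : 0 < l2norm v by rewrite lt_def v0 l2norm_ge0.
rewrite -ler_pdivrMr // mulrC -l2normZ ?invr_ge0 ?l2norm_ge0 // scalemxAr opnorm_ub //.
by rewrite l2normZ ?invr_ge0 ?l2norm_ge0 // mulVf.
Qed.

(** Cauchy-Schwarz for |Yu|^2 = <u, Y^* Y u>. It stands in for the equality of the norms of [Y] and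
    its adjoint. *)
Lemma l2norm_sqr_le p q (Y : 'M[C]_(p, q)) u :
  l2norm (Y *m u) ^+ 2 <= l2norm u * l2norm (Y ^t* *m (Y *m u)).
Proof.
rewrite -lecR; have := l2norm_CauchySchwarz u (Y ^t* *m (Y *m u)).
rewrite mulmxA -adjmxM -l2normE ger0_norm // ler0c; exact: sqr_ge0.
Qed.

Lemma opnorm_adj_mul p q (X : 'M[C]_(p, q)) : opnorm (X ^t* *m X) = opnorm X ^+ 2.
Proof.
apply/eqP; rewrite eq_le; apply/andP; split.
  (* For w = X^* X v one has |w|^2 <= |Xv| |Xw| <= |X|^2 |w|, and |w| cancels. *)
  apply: opnorm_le => v v1; rewrite -mulmxA; set w := X ^t* *m _.
  have [->|w0] := eqVneq (l2norm w) 0; first exact: sqr_ge0.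
  have wgt0 : 0 < l2norm w by rewrite lt_def w0 l2norm_ge0.
  rewrite -(ler_pM2r wgt0) -[_ * _ in leLHS]expr2.
  have := l2norm_sqr_le (X ^t* ) (X *m v); rewrite trmxCK => /le_trans; apply.
  rewrite expr2 -mulrA ler_pM ?l2norm_ge0 ?l2norm_mulmx_le ?opnorm_ub //.
have XX0 := opnorm_ge0 (X ^t* *m X).
rewrite -[leRHS](sqr_sqrtr XX0) ler_sqr ?nnegrE ?opnorm_ge0 ?sqrtr_ge0 //.
apply: opnorm_le => v v1; rewrite -ler_sqr ?nnegrE ?l2norm_ge0 ?sqrtr_ge0 //.
rewrite [leRHS]sqr_sqrtr //; apply: (le_trans (l2norm_sqr_le X v)).
by rewrite mulmxA -[leRHS]mul1r ler_pM ?l2norm_ge0 ?opnorm_ub.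
Qed.

(** The adjoint of [W] maps the unit ball onto the unit ball: it is a contraction, and every v
    equals W^* W v with |Wv| = |v|. *)
Lemma opnorm_mul_adj_isometry p k d (Y : 'M[C]_(p, d)) (W : 'M[C]_(k, d)) :
  W ^t* *m W = 1%:M -> opnorm (Y *m W ^t* ) = opnorm Y.
Proof.
move=> WW; have W1 u : l2norm u <= 1 -> l2norm (W ^t* *m u) <= 1.
  move=> u1; have := l2norm_sqr_le (W ^t* ) u; rewrite trmxCK (l2norm_isometry _ WW).
  have [->|w0] := eqVneq (l2norm (W ^t* *m u)) 0; first by rewrite ler01.
  have wgt0 : 0 < l2norm (W ^t* *m u) by rewrite lt_def w0 l2norm_ge0.
  by rewrite expr2 ler_pM2r // => /le_trans; apply.
apply/eqP; rewrite eq_le; apply/andP; split.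
  by apply: opnorm_le => u u1; rewrite -mulmxA opnorm_ub ?W1.
apply: opnorm_le => v v1; rewrite -[v in leLHS]mul1mx -WW -(mulmxA _ _ v) mulmxA.
by rewrite opnorm_ub // l2norm_isometry.
Qed.

End OperatorNorm.

(** * Kraus maps, Stinespring operators and complete positivity *)

Section Kraus.
Variable R : realType.
Local Notation C := R[i].

Lemma sum_mxtens (U : nmodType) m n (F : 'I_(m * n) -> U) :
  \sum_k F k = \sum_i \sum_j F (mxtens_index (i, j)).
Proof.
rewrite pair_big /= (reindex (@mxtens_index m n)) /=; last first.
  by exists (@mxtens_unindex m n) => k _; rewrite ?mxtens_indexK ?mxtens_unindexK.
by apply: eq_bigr => -[i j].
Qed.

(** A Kronecker product merely replaces the stacked family by another one, so computations with
    Stinespring operators become sums over Kraus families. *)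
Lemma tensmx_stinespring_op p' p q r' r (A : 'M[C]_(p', p)) (D : 'M[C]_(r', r))
    (V : 'I_r -> 'M[C]_(p, q)) :
  (A *t D) *m stinespring_op V
  = stinespring_op (fun i => \sum_j D i j *: (A *m V j)).
Proof.
apply/matrixP => k b; rewrite !mxE summxE sum_mxtens exchange_big /=.
apply: eq_bigr => j _; rewrite !mxE mulr_sumr; apply: eq_bigr => x _.
by rewrite !mxE mxtens_indexK /= mulrCA mulrA.
Qed.

Lemma stinespring_op_dot p q r (V V' : 'I_r -> 'M[C]_(p, q)) :
  (stinespring_op V) ^t* *m stinespring_op V' = \sum_i (V i) ^t* *m V' i.
Proof.
apply/matrixP => a b; rewrite !mxE summxE sum_mxtens exchange_big /=.
apply: eq_bigr => i _; rewrite !mxE; apply: eq_bigr => x _.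
by rewrite !mxE mxtens_indexK.
Qed.

Lemma kraus_mapE p q r (V : 'I_r -> 'M[C]_(p, q)) B :
  kraus_map V B = (stinespring_op V) ^t* *m (B *t 1%:M) *m stinespring_op V.
Proof.
rewrite -mulmxA tensmx_stinespring_op stinespring_op_dot; apply: eq_bigr => i _.
rewrite (bigD1 i) //= mxE eqxx scale1r big1 ?addr0 ?mulmxA // => j ji.
by rewrite mxE eq_sym (negPf ji) scale0r.
Qed.

Lemma submapE p q r (V : 'I_r -> 'M[C]_(p, q)) D B :
  submap V D B = (stinespring_op V) ^t* *m (B *t D) *m stinespring_op V.
Proof. by rewrite /submap -[_ *m _ *m (1%:M *t D)]mulmxA -tensmx_decr. Qed.

Lemma mxblock_form N p (B : 'I_N -> 'I_N -> 'M[C]_p) (v : 'I_N -> 'cV[C]_p) :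
  (\mxcol_i v i) ^t* *m \mxblock_(i, j) B i j *m \mxcol_i v i
  = \sum_j (\sum_i (v i) ^t* *m B i j) *m v j.
Proof.
have -> : (\mxcol_i v i) ^t* = \mxrow_i (v i) ^t*.
  by rewrite tr_mxcol; apply/matrixP => a b; rewrite !mxE.
by rewrite mul_mxrow_mxblock mul_mxrow_mxcol.
Qed.

Lemma kraus_map_linear p q r (V : 'I_r -> 'M[C]_(p, q)) : linear (kraus_map V).
Proof.
move=> a A B; rewrite /kraus_map scaler_sumr -big_split; apply: eq_bigr => i _ /=.
by rewrite mulmxDr mulmxDl -scalemxAr -scalemxAl.
Qed.

Lemma kraus_map_cp p q r (V : 'I_r -> 'M[C]_(p, q)) : completely_positive (kraus_map V).
Proof.
split=> [|N A psdA]; first exact: kraus_map_linear.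
rewrite /kraus_map mxblock_sum; apply: psd_sum => k v.
rewrite -(submxcolK v) mxblock_form.
(* The k-th summand is the form of the original block matrix at the vectors V_k v_i. *)
have := psdA (\mxcol_i (V k *m submxcol v i)); rewrite mxblock_form.
congr (_ <= fun_of_matrix _ _ _); apply: eq_bigr => j _.
rewrite mulmxA; congr (_ *m _); rewrite mulmx_suml; apply: eq_bigr => i _.
by rewrite adjmxM !mulmxA.
Qed.

Lemma completely_positive_comp p q r (Phi : 'M[C]_q -> 'M[C]_r) (Psi : 'M[C]_p -> 'M[C]_q) :
  completely_positive Phi -> completely_positive Psi -> completely_positive (Phi \o Psi).
Proof.
move=> [linP cpP] [linS cpS]; split=> [a A B|N A psdA /=]; first by rewrite /= linS linP.
exact/cpP/cpS.
Qed.

Lemma submap_cp p q r (V : 'I_r -> 'M[C]_(p, q)) P :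
  projection P -> completely_positive (submap V P).
Proof.
(* Since P = P^* P, the projection is absorbed into new Kraus operators; the factor [1%:M] matches
   the shape of [tensmx_stinespring_op]. *)
move=> [Ps PP]; rewrite (_ : submap V P = kraus_map (fun i => \sum_j P i j *: (1%:M *m V j))).
  exact: kraus_map_cp.
apply/funext => B; rewrite kraus_mapE -tensmx_stinespring_op submapE adjmxM.
have -> : B *t P = (1%:M *t P) *m (B *t 1%:M) *m (1%:M *t P).
  by rewrite !tensmx_mul !(mul1mx, mulmx1) PP.
by rewrite adjmx_tens adjmx1 Ps !mulmxA.
Qed.

(** For a projection [P], the difference is again the submap of a projection, which yields
    domination in the completely positive order. *)
Lemma submap_complement p q r (V : 'I_r -> 'M[C]_(p, q)) P B :
  submap V (1%:M - P) B = kraus_map V B - submap V P B.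
Proof. by rewrite kraus_mapE !submapE -mulmxBl -mulmxBr -tensmxBr. Qed.

End Kraus.

(** * Uniqueness of Radon-Nikodym derivatives and independence of the representation *)

Section RadonNikodym.
Variable R : realType.
Local Notation C := R[i].
Variables (p q : nat) (Phi Psi : 'M[C]_p -> 'M[C]_q).

Section Minimal.
Variables (k : nat) (sigma : 'M[C]_p -> 'M[C]_k) (T : 'M[C]_(k, q)).
Hypothesis minT : minimal_stinespring Psi sigma T.

(** Taking A = B^* makes z orthogonal to every sigma(B) T y, and these vectors span. *)
Lemma minimal_stinespring_eq0 (z : 'cV[C]_k) :
  (forall A, T ^t* *m sigma A *m z = 0) -> z = 0.
Proof.
case: minT => -[_ _ _ sigmaS] _ spanT z0; apply: adjmx_mul_eq0.
have [N [A [y zE]]] := spanT z; rewrite {1}zE adjmx_sum mulmx_suml big1 // => a _.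
by rewrite !adjmxM -sigmaS -mulmxA z0 mulmx0.
Qed.

(** Uniqueness in the Radon-Nikodym theorem: on spanning vectors, commutation turns T^* sigma(A) X
    sigma(B) T into T^* sigma(AB) X T. *)
Lemma minimal_stinespring_commutant_inj (X Y : 'M[C]_k) :
  (forall A, X *m sigma A = sigma A *m X) ->
  (forall A, Y *m sigma A = sigma A *m Y) ->
  (forall A, T ^t* *m sigma A *m X *m T = T ^t* *m sigma A *m Y *m T) ->
  X = Y.
Proof.
move=> Xc Yc XY; apply: mul1mxP => v; apply/eqP; rewrite -subr_eq0; apply/eqP.
apply: minimal_stinespring_eq0 => A; apply/eqP; rewrite mulmxBr subr_eq0; apply/eqP.
case: minT => -[_ _ sigmaM _] _ spanT; have [N [B [y ->]]] := spanT v.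
rewrite !mulmx_sumr; apply: eq_bigr => a _; rewrite !mulmxA.
rewrite -(mulmxA _ X) Xc -(mulmxA _ Y) Yc !mulmxA -!(mulmxA _ (sigma A)) -sigmaM.
by rewrite XY.
Qed.

End Minimal.

(* Any expansion of E T y along sigma gives, with the same coefficients, one of
   E' T' y along sigma', so no intertwining unitary has to be built. *)
Lemma RN_derivative_idempotent k k' sigma sigma' (T : 'M[C]_(k, q)) (T' : 'M[C]_(k', q)) E E' :
  RN_derivative Phi Psi sigma T E -> RN_derivative Phi Psi sigma' T' E' ->
  E' *m E' = E' -> E *m E = E.
Proof.
move=> [minT _ Ec PhiE] [minT' _ E'c PhiE'] EE'.
have [[_ _ sigmaM _] PsiE spanT] := minT.
have [[_ _ sigmaM' _] PsiE' _] := minT'.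
apply: (minimal_stinespring_commutant_inj minT) => [A|//|A].
  by rewrite -mulmxA Ec mulmxA Ec mulmxA.
rewrite -PhiE; apply: mul1mxP => y; have [N [B [w ETy]]] := spanT (E *m T *m y).
have E'Ty : E' *m T' *m y = \sum_a sigma' (B a) *m T' *m w a.
  (* Against T'^* sigma'(D), the left side is Phi(D) y = T^* sigma(D) E T y, and both sides become
     the sum of Psi(D B_a) w_a. *)
  apply/eqP; rewrite -subr_eq0; apply/eqP; apply: (minimal_stinespring_eq0 minT') => D.
  rewrite mulmxBr !mulmxA -PhiE' PhiE -(mulmxA _ E T) -(mulmxA _ (E *m T) y) ETy !mulmx_sumr.
  apply/eqP; rewrite subr_eq0; apply/eqP; apply: eq_bigr => a _.
  by rewrite !mulmxA -!(mulmxA _ (sigma D)) -!(mulmxA _ (sigma' D)) -sigmaM -sigmaM' -PsiE -PsiE'.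
(* The terms with E E and with E' E' both reduce to the sum of Phi(A B_a) w_a; idempotency of E'
   identifies the second with Phi(A) y. *)
have -> : T ^t* *m sigma A *m (E *m E) *m T *m y
    = T ^t* *m sigma A *m E *m (E *m T *m y) by rewrite !mulmxA.
rewrite ETy mulmx_sumr PhiE' -{1}EE'.
have -> : T' ^t* *m sigma' A *m (E' *m E') *m T' *m y
    = T' ^t* *m sigma' A *m E' *m (E' *m T' *m y) by rewrite !mulmxA.
rewrite E'Ty mulmx_sumr; apply: eq_bigr => a _.
rewrite !mulmxA -!(mulmxA _ E) -!(mulmxA _ E') Ec E'c !mulmxA.
by rewrite -!(mulmxA _ (sigma A)) -!(mulmxA _ (sigma' A)) -sigmaM -sigmaM'
  -PhiE -PhiE'.
Qed.

End RadonNikodym.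

(** The quadratic form splits over the slices [w a] of [v] along the first tensor factor. *)
Lemma psd_tens1 (R : realType) k p (B : 'M[R[i]]_p) :
  psd B -> psd ((1%:M : 'M[R[i]]_k) *t B).
Proof.
move=> psdB v; pose w a := \col_j v (mxtens_index (a, j)) 0.
have -> : (v ^t* *m (1%:M *t B) *m v) 0 0 = \sum_a ((w a) ^t* *m B *m w a) 0 0.
  rewrite mxE sum_mxtens; apply: eq_bigr => a _; rewrite [RHS]mxE.
  apply: eq_bigr => j _; rewrite [w a j 0]mxE; congr (_ * _).
  rewrite mxE sum_mxtens [RHS]mxE (bigD1 a) //= [X in _ + X]big1 ?addr0 => [|a' a'a].
    by apply: eq_bigr => i _; rewrite tensmxE !mxE eqxx mul1r.
  by apply: big1 => i _; rewrite tensmxE [1%:M _ _]mxE (negPf a'a) mul0r mulr0.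
exact: sumr_ge0.
Qed.

(** * The pullback represented on the coefficient space *)

Section Pullback.
Variable R : realType.
Local Notation C := R[i].
Variables (l m n r s d : nat).
Variables (V : 'I_r -> 'M[C]_(m, n)) (L : 'I_s -> 'M[C]_(l, m)).
Variable W : 'M[C]_(s * r, d).
Hypothesis W_basis : orthonormal_basis (coefficient_space V L) W.

Local Notation K := (composite_kraus V L).
Local Notation S := (stinespring_op K).
Local Notation T := (pullback_op V L W).

Lemma composite_sum (c : 'cV[C]_(s * r)) :
  \sum_(j < s) \sum_(i < r) c (mxtens_index (j, i)) 0 *: (L j *m V i)
  = \sum_k c k 0 *: K k.
Proof.
rewrite sum_mxtens; apply: eq_bigr => j _; apply: eq_bigr => i _.
by rewrite /composite_kraus mxtens_indexK.
Qed.

(** A relation among the operators K_k, read at the position (a, b), is exactly a vanishing bilinear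
    pairing; no conjugate appears. *)
Lemma coefficient_space_entries a b : coefficient_space V L (\col_k K k a b).
Proof.
move=> c; rewrite /relation_space /= composite_sum => /matrixP/(_ a b).
rewrite summxE mxE => cK0; rewrite -[RHS]cK0; apply: eq_bigr => k _.
by rewrite !mxE.
Qed.

Lemma stinespring_op_coefficient_space :
  ((1%:M : 'M[C]_l) *t (W *m W ^t*)) *m S = S.
Proof.
case: W_basis => WW EW; rewrite tensmx_stinespring_op.
apply/matrixP => ak b; rewrite [LHS]mxE summxE [RHS]mxE.
case: (mxtens_unindex ak) => a k /=.
(* For fixed a and b, the entries of S form a vector in the range of [W], which W W^* fixes. *)
have [x Kx] := (EW _).1 (coefficient_space_entries a b).
have : (W *m W ^t* *m \col_k K k a b) k 0 = K k a b.
  by rewrite Kx -mulmxA (mulmxA _ W) WW mul1mx -Kx mxE.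
rewrite [LHS]mxE => <-; apply: eq_bigr => k' _.
by rewrite mul1mx [(\col__ _) _ _]mxE [LHS]mxE.
Qed.

(** Expanding T leaves W W^* on both sides of X, next to S and its adjoint; there it is absorbed
    because it fixes S. *)
Lemma pullback_op_compression A (X : 'M[C]_(s * r)) :
  T ^t* *m (A *t (W ^t* *m X *m W)) *m T = S ^t* *m (A *t X) *m S.
Proof.
rewrite /pullback_op adjmxM adjmx_tens adjmx1 trmxCK.
have sandwich : (1%:M *t W) *m (A *t (W ^t* *m X *m W)) *m (1%:M *t W ^t* )
    = (1%:M *t (W *m W ^t* )) *m (A *t X) *m (1%:M *t (W *m W ^t* )).
  by rewrite !tensmx_mul !mul1mx !mulmx1 !mulmxA.
rewrite [LHS]mulmxA -!(mulmxA (S ^t* )) sandwich [RHS]mulmxA -[in RHS]stinespring_op_coefficient_space.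
by rewrite adjmxM adjmx_tens adjmx1 adjmxM trmxCK !mulmxA.
Qed.

(** On the coefficients of the family L_j V_i, [D] acts in the second factor only and leaves the
    Kraus index of Lambda untouched. *)
Lemma submap_pullback D A :
  submap V D (kraus_map L A) = S ^t* *m (A *t (1%:M *t D)) *m S.
Proof.
rewrite submapE -!mulmxA !tensmx_stinespring_op !stinespring_op_dot.
rewrite sum_mxtens exchange_big /=; apply: eq_bigr => i _.
rewrite /kraus_map mulmx_sumr; under [LHS]eq_bigr => i' _.
  rewrite -scalemxAr mulmx_suml mulmx_sumr scaler_sumr; over.
rewrite exchange_big /=; apply: eq_bigr => j _.
rewrite sum_mxtens (bigD1 j) //= [X in _ *m (_ + X)]big1 ?addr0 => [|j' jj'].
  rewrite mulmx_sumr; apply: eq_bigr => i' _.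
  rewrite tensmxE mxE eqxx mul1r -scalemxAr; congr (_ *: _).
  by rewrite /composite_kraus !mxtens_indexK /= adjmxM !mulmxA.
rewrite big1 // => i' _.
by rewrite tensmxE mxE eq_sym (negPf jj') mul0r scale0r.
Qed.

(** The entry vectors of the composite family span the coefficient space, so their coordinates in
    the basis [W] form a matrix with a right inverse. This inverse [G] is a dual frame, from which
    minimality is solved explicitly. *)
Lemma coefficient_frame :
  exists G : 'I_l -> 'I_n -> 'I_d -> C, forall t t' : 'I_d,
    \sum_b \sum_a (\sum_k (W ^t* ) t k * K k a b) * G a b t' = (t == t')%:R.
Proof.
case: W_basis => WW EW.
pose M := \matrix_(k, ab) K k (mxtens_unindex ab).1 (mxtens_unindex ab).2.
suff /row_freeP [G MG] : row_free (W ^t* *m M).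
  exists (fun a b t => G (mxtens_index (a, b)) t) => t t'.
  have /matrixP/(_ t t') := MG; rewrite [LHS]mxE [RHS]mxE => <-.
  rewrite sum_mxtens exchange_big /=; apply: eq_bigr => a _; apply: eq_bigr => b _.
  congr (_ * _); rewrite [RHS]mxE; apply: eq_bigr => k _.
  by rewrite [M _ _]mxE mxtens_indexK.
(* A row x killed by W^* M gives a relation among the K_k; pairing it with the vector W e_t of the
   coefficient space yields x_t = 0. *)
apply: inj_row_free => x xM0.
have relx : relation_space V L (x *m W ^t* )^T.
  rewrite /relation_space /= composite_sum; apply/matrixP => a b.
  have /matrixP/(_ 0 (mxtens_index (a, b))) := xM0; rewrite mulmxA !mxE => xM.
  rewrite -[RHS]xM summxE; apply: eq_bigr => k _.
  by rewrite [M _ _]mxE mxtens_indexK !mxE.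
apply/rowP => t; rewrite mxE; pose e : 'cV[C]_d := delta_mx t 0.
have We : coefficient_space V L (W *m e) by apply/EW; exists e.
have := We _ relx.
have -> : \sum_k (x *m W ^t* )^T k 0 * (W *m e) k 0 = (x *m W ^t* *m (W *m e)) 0 0.
  by rewrite [RHS]mxE; apply: eq_bigr => k _; rewrite [_^T _ _]mxE.
by rewrite -mulmxA (mulmxA _ W) WW mul1mx -colE mxE.
Qed.

Lemma pullback_minimal Psi :
  Psi =1 (fun A => S ^t* *m (A *t 1%:M) *m S) ->
  minimal_stinespring Psi (pullback_rep (l := l) d) T.
Proof.
move=> PsiE; case: (W_basis) => WW _; split=> [|A|x].
- split=> [a A B||A B|A].
  + by apply/matrixP => i j; rewrite !mxE mulrDl mulrA.
  + exact: tensmx11.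
  + by rewrite /pullback_rep tensmx_mul mulmx1.
  + by rewrite /pullback_rep adjmx_tens adjmx1.
- by rewrite PsiE -pullback_op_compression mulmx1 WW.
have [G GK] := coefficient_frame.
(* The coefficients come from the dual frame: applying A_b (x) I to T e_b and summing over the
   standard basis of C^n returns x. *)
pose A b := \matrix_(a, a') \sum_t x (mxtens_index (a, t)) 0 * G a' b t.
exists n, A, (fun b => delta_mx b 0).
apply/matrixP => at_ j; rewrite ord1 {j} summxE.
rewrite -(mxtens_unindexK at_); case: (mxtens_unindex at_) => a t {at_}.
transitivity (\sum_t' x (mxtens_index (a, t')) 0 * (t == t')%:R).
  rewrite (bigD1 t) //= eqxx mulr1 big1 ?addr0 // => t' t't.
  by rewrite eq_sym (negPf t't) mulr0.
under eq_bigr => t' _.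
  rewrite -GK mulr_sumr; over.
rewrite exchange_big /=; apply: eq_bigr => b _.
rewrite /pullback_rep /pullback_op tensmx_stinespring_op tensmx_stinespring_op -colE.
rewrite [RHS]mxE [RHS]mxE mxtens_indexK /= summxE.
rewrite [RHS](bigD1 t) //= [X in _ + X]big1 ?addr0 => [|t' t't]; last first.
  by rewrite [(1%:M : 'M_d) _ _]mxE eq_sym (negPf t't) scale0r mxE.
rewrite [(1%:M : 'M_d) _ _]mxE eqxx scale1r [RHS]mxE.
under eq_bigr => t' _ do rewrite mulr_sumr.
rewrite exchange_big /=; apply: eq_bigr => a' _.
rewrite [A b a a']mxE mulr_suml; apply: eq_bigr => t' _.
rewrite -mulrA [in RHS](mulrC (G _ _ _)); congr (_ * (_ * _)).
by rewrite summxE; apply: eq_bigr => k _; rewrite mul1mx [RHS]mxE.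
Qed.

Lemma pullback_RN Omega Lambda D :
  Omega =1 kraus_map V -> Lambda =1 kraus_map L -> psd D ->
  RN_derivative (submap V D \o Lambda) (Omega \o Lambda)
    (pullback_rep (l := l) d) T (1%:M *t (W ^t* *m (1%:M *t D) *m W)).
Proof.
move=> OmegaE LambdaE psdD; split=> [||A|A /=].
- apply: pullback_minimal => A; rewrite /= LambdaE OmegaE.
  by rewrite kraus_mapE -submapE submap_pullback tensmx11.
- exact/psd_tens1/psd_congr/psd_tens1.
- by rewrite /pullback_rep !tensmx_mul !mul1mx !mulmx1.
- rewrite LambdaE submap_pullback -pullback_op_compression.
  by rewrite -[_ *m _ *m (1%:M *t _)]mulmxA tensmx_mul mulmx1 mul1mx.
Qed.

(* A nonzero coefficient space forces l > 0. *)
Lemma tensmx1_coefficient_inj (X Y : 'M[C]_d) :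
  (1%:M : 'M[C]_l) *t X = 1%:M *t Y -> X = Y.
Proof.
move=> XY; apply/matrixP => t t'; suff /tensmx1_inj/(_ XY) -> : (0 < l)%N by [].
have [G GK] := coefficient_frame; case: (posnP l) => // l0.
have /eqP := GK t t; rewrite eqxx big1 => [|b _]; first by rewrite eq_sym oner_eq0.
by rewrite big1 // => -[a al]; exfalso; rewrite l0 in al.
Qed.

Lemma transferE Omega Lambda P :
  Omega =1 kraus_map V -> Lambda =1 kraus_map L -> psd P ->
  transfer V L Omega Lambda W P = W ^t* *m (1%:M *t P) *m W.
Proof.
move=> OmegaE LambdaE psdP.
(* [transfer] is a choice with a default value, so existence comes first: the compression of I (x)
   D, linear in D, is a witness. Uniqueness of the derivative then determines the value at [P]. *)
have [_ /(_ P psdP) RN] : is_transfer V L Omega Lambda W (transfer V L Omega Lambda W).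
  rewrite /transfer; apply: xgetPex; exists (fun D => W ^t* *m (1%:M *t D) *m W).
  split=> [a D D'|D psdD]; last exact: pullback_RN.
  have -> : 1%:M *t (a *: D + D') = a *: (1%:M *t D) + 1%:M *t D' :> 'M_(s * r).
    by apply/matrixP => i j; rewrite !mxE mulrDr mulrCA.
  by rewrite mulmxDr mulmxDl -scalemxAr -scalemxAl.
have [minT _ Fc FE] := RN; have [_ _ Gc GE] := pullback_RN OmegaE LambdaE psdP.
apply: tensmx1_coefficient_inj.
by apply: (minimal_stinespring_commutant_inj minT) => // A; rewrite -FE -GE.
Qed.

Lemma transfer_RN Omega Lambda P :
  Omega =1 kraus_map V -> Lambda =1 kraus_map L -> psd P ->
  RN_derivative (submap V P \o Lambda) (Omega \o Lambda)
    (pullback_rep (l := l) d) T (1%:M *t transfer V L Omega Lambda W P).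
Proof. by move=> OE LE psdP; rewrite transferE //; apply: pullback_RN. Qed.

Lemma defect_adjE Omega Lambda P :
  Omega =1 kraus_map V -> Lambda =1 kraus_map L -> projection P ->
  let X := (1%:M - W *m W ^t* ) *m (1%:M *t P) *m W in
  defect V L Omega Lambda W P = X ^t* *m X.
Proof.
move=> OE LE projP /=; case: (W_basis) => WW _.
have [Rs RR] := projection_tens s projP; set Rp := 1%:M *t P in Rs RR *.
have [] : projection (1%:M - W *m W ^t* ).
  apply: projectionB; split; first by rewrite adjmxM trmxCK.
  by rewrite mulmxA -[W *m _ *m W]mulmxA WW mulmx1.
set Q' := 1%:M - _ => Q's Q'Q'.
rewrite !adjmxM Rs Q's !mulmxA -(mulmxA _ Q' Q') Q'Q' /defect transferE //; last exact: projection_psd.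
(* Since [Rp] is idempotent, the expansion is W^* Rp W minus its square. *)
rewrite -/Rp /Q' mulmxBr mulmx1 !mulmxBl !mulmxA; congr (_ - _).
by rewrite -(mulmxA _ Rp Rp) RR.
Qed.

End Pullback.

(** * Defect formula, norm identity and sharpness criterion *)

Theorem corollary4p5 (R : realType) (l m n r s : nat)
    (Omega : 'M[R[i]]_m -> 'M[R[i]]_n) (Lambda : 'M[R[i]]_l -> 'M[R[i]]_m)
    (V : 'I_r -> 'M[R[i]]_(m, n)) (L : 'I_s -> 'M[R[i]]_(l, m))
    (Omega_cp : completely_positive Omega) (Omega_kraus : minimal_kraus Omega V)
    (Lambda_cp : completely_positive Lambda)
    (Lambda_kraus : Lambda =1 kraus_map L)
    (d : nat) (W : 'M[R[i]]_(s * r, d))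
    (W_basis : orthonormal_basis (coefficient_space V L) W)
    (P : 'M[R[i]]_r) (P_proj : projection P) :
  let PE := orthoproj (coefficient_space V L) in
  let RP := (1%:M : 'M[R[i]]_s) *t P in
  let Delta := defect V L Omega Lambda W P in
  [/\ Delta = restr W (PE *m RP *m (1%:M - PE) *m RP *m PE),
      opnorm Delta = opnorm ((1%:M - PE) *m RP *m PE) ^+ 2
    & Delta = 0 <-> sharp (submap V P \o Lambda) (Omega \o Lambda)].

Proof.
move=> PE RP Delta; have [OE _] := Omega_kraus.
have [WW _] := W_basis; have PEE : PE = W *m W ^t* := orthoproj_basis W_basis.
have PEW : PE *m W = W by rewrite PEE -mulmxA WW mulmx1.
have [RPs _] := projection_tens s P_proj; rewrite -/RP in RPs.
have PEs : PE ^t* = PE by rewrite PEE adjmxM trmxCK.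
have WPE : W ^t* *m PE = W ^t* by rewrite -{1}PEs -adjmxM PEW.
have [P's P'P'] : projection (1%:M - PE).
  by apply: projectionB; split=> //; rewrite {2}PEE mulmxA PEW -PEE.
have DeltaE := defect_adjE W_basis OE Lambda_kraus P_proj.
rewrite /= -PEE -/RP -/Delta in DeltaE; split.
(* [W] absorbs the outer factors [PE], and the two copies of the complementary projection merge. *)
- rewrite DeltaE /restr !adjmxM P's RPs -!mulmxA PEW !mulmxA.
  by rewrite -(mulmxA _ (1%:M - PE) (1%:M - PE)) P'P' WPE.
(* Right multiplication by the adjoint of [W] preserves the norm and turns the trailing [W] into
   [PE]. *)
- rewrite DeltaE opnorm_adj_mul; congr (_ ^+ 2).
  by rewrite -(opnorm_mul_adj_isometry _ WW) -(mulmxA _ W) -PEE.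
have psdP := projection_psd P_proj.
have RN := transfer_RN W_basis OE Lambda_kraus psdP.
split=> [Delta0|[_ _ [k [sigma [T' [E [RN' [_ EE]]]]]]]].
  split; first exact: completely_positive_comp (submap_cp V P_proj) Lambda_cp.
    have complementE : (fun A => (Omega \o Lambda) A - (submap V P \o Lambda) A)
        = submap V (1%:M - P) \o Lambda.
      by apply/funext => A /=; rewrite submap_complement OE.
    rewrite /cple complementE.
    exact: completely_positive_comp (submap_cp V (projectionB P_proj)) Lambda_cp.
  (* The concrete representation serves as witness: a zero defect is idempotency of the transfer. *)
  exists (l * d)%N, (pullback_rep d), (pullback_op V L W),
    (1%:M *t transfer V L Omega Lambda W P); split; first exact: RN.
  apply: projection_tens; split; last by apply/esym/eqP; rewrite -subr_eq0; apply/eqP.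
  by rewrite (transferE W_basis) // !adjmxM trmxCK RPs mulmxA.
(* Idempotency in the given minimal representation passes to the concrete derivative, where the
   identity factor is cancelled. *)
apply/eqP; rewrite subr_eq0; apply/eqP/(tensmx1_coefficient_inj W_basis).
by rewrite -[LHS](RN_derivative_idempotent RN RN' EE) tensmx_mul mulmx1.
Qed.
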